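(* Let $d\ge 2$ be a fixed integer, let $\delta\in[0,1)$ be a constant, let $s=s_n=n^{-(d-1)+\delta+o(1)}$, and let $(\mathcal H,A)\sim\mathbb P$ be sampled from the noisy projection model with parameters $0\le q=q_n\le p=p_n\le1$ defined in the context. Suppose that $p=1-\Omega(1)$, i.e. there is a constant $c_0>0$ with $p_n\le 1-c_0$ for all large $n$. Then for any estimator $\widehat{\mathcal H}=\widehat{\mathcal H}(A)$ (a function of $A$ taking values in sets of $d$-element subsets of $[n]$), $$\mathbb E_{(\mathcal H,A)\sim\mathbb P}\big[|\widehat{\mathcal H}(A)\,\triangle\,\mathcal H|\big]=\Omega(1)\cdot s\tbinom nd\qquad(n\to\infty),$$ and this holds even when $q=0$.
   Context: Model. $\operatorname U_{n,d}$ is the collection of all $d$-element subsets of $[n]=\{1,\dots,n\}$. The random $d$-uniform hypergraph $\mathcal H$ on $[n]$ (identified with its set of hyperedges) includes each $\Psi\in \operatorname U_{n,d}$ independently with probability $s\in[0,1]$. The projection $\mathcal P(\mathcal H)$ is the graph on $[n]$ in which an unordered pair $(i,j)$, $i\ne j$, is an edge if and only if some $\Psi\in\mathcal H$ contains both $i$ and $j$. Under $\mathbb P$: first sample $\mathcal H$; then, conditionally on $\mathcal H$, the random graph $A$ on $[n]$ includes, independently over pairs, each pair $(i,j)\in\mathcal P(\mathcal H)$ with probability $p$ and each pair $(i,j)\notin\mathcal P(\mathcal H)$ with probability $q$. $\triangle$ denotes symmetric difference of sets of hyperedges. $a_n=\Omega(1)\cdot b_n$ means that there is a constant $c>0$ with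 $a_n\ge c\,b_n$ for all sufficiently large $n$. All asymptotics are as $n\to\infty$ with $d,\delta$ fixed. *)

(* Defs.v *)
From mathcomp Require Import all_boot all_order all_algebra.
From mathcomp Require Import all_classical all_reals all_analysis.

Set Implicit Arguments.
Unset Strict Implicit.
Unset Printing Implicit Defensive.

Import Order.TTheory GRing.Theory Num.Theory.
Import numFieldNormedType.Exports.

Local Open Scope ring_scope.

(* The vertex set [n] is 'I_n.  Since subsets d n is a finType, a d-uniform
   hypergraph on [n] is an element of {set subsets d n}. *)
Definition subsets (d n : nat) := {Psi : {set 'I_n} | #|Psi| == d}.

Definition hypergraph (d n : nat) := {set subsets d n}.

Definition graph (n : nat) := hypergraph 2 n.

Definition projection (d n : nat) (H : hypergraph d n) : graph n :=
  [set e : subsets 2 n | [exists Psi in H, val e \subset val Psi]].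

Definition symdiff (T : finType) (A B : {set T}) : {set T} :=
  (A :\: B) :|: (B :\: A).

(* Probability that the random subset of T containing each x independently
   with probability f x is equal to S. *)
Definition indep_mass (R : realType) (T : finType) (f : T -> R)
    (S : {set T}) : R :=
  \prod_(x : T) (if x \in S then f x else 1 - f x).

Definition hypergraph_mass (R : realType) (d n : nat) (s : R)
    (H : hypergraph d n) : R :=
  indep_mass (fun=> s) H.

(* Conditional probability of the graph A given the hypergraph H. *)
Definition graph_mass (R : realType) (d n : nat) (p q : R)
    (H : hypergraph d n) (A : graph n) : R :=
  indep_mass (fun e => if e \in projection H then p else q) A.

Definition model_expectation (R : realType) (d n : nat) (s p q : R)
    (F : hypergraph d n -> graph n -> R) : R :=
  \sum_(H : hypergraph d n) \sum_(A : graph n)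
    hypergraph_mass s H * graph_mass p q H A * F H A.

(* u_n = n ^ (a + o(1)) *)
Definition power_o1 (R : realType) (u : nat -> R) (a : R) : Prop :=
  exists2 eps : nat -> R, (eps @ \oo --> (0 : R))%classic
    & \forall n \near \oo%classic, u n = n%:R `^ (a + eps n).

(* u_n = Omega(1) * v_n *)
Definition Omega1 (R : realType) (u v : nat -> R) : Prop :=
  exists2 c : R, 0 < c & \forall n \near \oo%classic, c * v n <= u n.

(* Main.v *)
(** Fix a hyperedge [Psi] and pair every [H] not containing [Psi] with [Psi |: H].
    If [A] has no edge inside [Psi], which given [H] has probability at least
    [c0 ^ 'C(d, 2)], then passing from [H] to [Psi |: H] changes the likelihood
    of [A] by a factor at least [c0 ^ 'C(d, 2)], while the prior odds are
    [s : 1 - s]. Whichever way the estimator decides on [Psi], it thus errs with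
    probability at least of order [s]; summing over [Psi] gives the bound. *)
Require Import Defs.
From mathcomp Require Import all_boot all_order all_algebra.
From mathcomp Require Import all_classical all_reals all_analysis.
From mathcomp Require Import lra.
Import Order.TTheory GRing.Theory Num.Theory.
Import numFieldNormedType.Exports.
Local Open Scope ring_scope.

Set Implicit Arguments.
Unset Strict Implicit.
Unset Printing Implicit Defensive.

Lemma indep_mass_ge0 (R : realType) (T : finType) (f : T -> R) (S : {set T}) :
  (forall x, 0 <= f x <= 1) -> 0 <= indep_mass f S.
Proof.
move=> f01; apply: prodr_ge0 => x _; have /andP[f0 f1] := f01 x.
by case: ifP => _ //; rewrite subr_ge0.
Qed.

(** Expand a product of binomials over all subsets: putting [0] for [f x] on [D] kills exactly the
    sets that meet [D]. *)
Lemma sum_indep_mass_disjoint (R : realType) (T : finType) (f : T -> R)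
    (D : {set T}) :
  \sum_(S : {set T} | [disjoint S & D]) indep_mass f S
    = \prod_(x in D) (1 - f x).
Proof.
transitivity (\prod_x ((if x \in D then 0 else f x) + (1 - f x))); last first.
  rewrite (big_mkcond (fun x => x \in D)); apply: eq_bigr => x _.
  by case: ifP => _; rewrite ?add0r // addrC subrK.
rewrite bigA_distr big_mkcond; apply: eq_bigr => S _.
case: ifPn => [dSD|].
  apply: eq_bigr => x _; case: ifP => // xS.
  by rewrite (disjointFr dSD xS).
rewrite -finset.setI_eq0 => /finset.set0Pn[x /finset.setIP[xS xD]].
by rewrite (bigD1 x) //= xS xD mul0r.
Qed.

Lemma sum_indep_mass (R : realType) (T : finType) (f : T -> R) :
  \sum_(S : {set T}) indep_mass f S = 1.
Proof.
rewrite -[RHS](finset.big_set0 _ *%R (fun x => 1 - f x)) -sum_indep_mass_disjoint.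
by apply: eq_bigl => S; rewrite disjoint_sym finset.disjoints_subset finset.sub0set.
Qed.

(** Factor by factor: outside [D] the factors coincide, and at [x] in [D], which is absent from [S],
    [c * (1 - f x) <= c <= 1 - g x]. *)
Lemma indep_mass_compare (R : realType) (T : finType) (f g : T -> R)
    (D S : {set T}) (c : R) :
  (forall x, 0 <= f x <= 1) -> 0 <= c ->
  {in D, forall x, c <= 1 - g x} ->
  (forall x, x \notin D -> g x = f x) ->
  [disjoint S & D] ->
  c ^+ #|D| * indep_mass f S <= indep_mass g S.
Proof.
move=> f01 c0 cg gf dSD.
rewrite -prodr_const (big_mkcond (fun x => x \in D)) -big_split /=.
apply: ler_prod => x _; have /andP[f0 f1] := f01 x.
have [xD|xD] := boolP (x \in D); last first.
  by rewrite mul1r (gf _ xD) lexx andbT; case: ifP => _ //; rewrite subr_ge0.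
rewrite (disjointFl dSD xD) mulr_ge0 ?subr_ge0 //=.
by apply: le_trans (cg _ xD); rewrite ler_piMr // gerBl.
Qed.

Lemma sum_setU1 (R : realType) (T : finType) (a : T) (F : {set T} -> R) :
  \sum_(S : {set T}) F S = \sum_(S : {set T} | a \notin S) (F S + F (a |: S)).
Proof.
rewrite (bigID (fun S : {set T} => a \notin S)) big_split /=; congr (_ + _).
rewrite (reindex_onto (fun S => a |: S) (fun S => S :\ a)) /=.
  apply: eq_bigl => S; rewrite finset.setU11 /=.
  apply/eqP/idP => [<-|]; last exact: finset.setU1K.
  by rewrite !inE eqxx.
by move=> S; rewrite negbK => /finset.setD1K.
Qed.

Lemma indep_mass_setU1 (R : realType) (T : finType) (s : R) (a : T)
    (S : {set T}) :
  a \notin S ->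
  let m := indep_mass (fun=> s) S + indep_mass (fun=> s) (a |: S) in
  indep_mass (fun=> s) S = (1 - s) * m /\ indep_mass (fun=> s) (a |: S) = s * m.
Proof.
move=> aS; rewrite /indep_mass.
(* The two masses share the factors away from [a]; since [(1 - s) + s = 1], this common product is
   [m]. *)
set P := \prod_(x | x != a) (if x \in S then s else 1 - s).
have -> : \prod_x (if x \in S then s else 1 - s) = (1 - s) * P.
  by rewrite (bigD1 a) //= (negbTE aS).
have -> : \prod_x (if x \in a |: S then s else 1 - s) = s * P.
  rewrite (bigD1 a) //= finset.setU11; congr (_ * _).
  by apply: eq_bigr => x xa; rewrite finset.in_setU1 (negbTE xa).
by rewrite -mulrDl subrK mul1r.
Qed.

Lemma card_subsets (d n : nat) : #|{: subsets d n}| = 'C(n, d).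
Proof.
rewrite card_sig -[n in RHS]card_ord -card_draws.
by apply: eq_card => A; rewrite !inE.
Qed.

Definition inner_pairs (d n : nat) (Psi : subsets d n) : graph n :=
  [set e : subsets 2 n | val e \subset val Psi].

Lemma card_inner_pairs (d n : nat) (Psi : subsets d n) :
  #|inner_pairs Psi| = 'C(d, 2).
Proof.
rewrite -[X in 'C(X, _)](eqP (valP Psi)) -cards_draws -(card_imset _ val_inj).
apply: eq_card => B; apply/imsetP/idP => [[e]|].
  by rewrite !inE => eP ->; rewrite eP (valP e).
rewrite inE => /andP[BP B2]; exists (exist _ B B2) => //.
by rewrite inE.
Qed.

Lemma projection_setU1 (d n : nat) (Psi : subsets d n) (H : hypergraph d n) e :
  e \notin inner_pairs Psi ->
  (e \in projection (Psi |: H)) = (e \in projection H).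
Proof.
rewrite !inE => eP; apply/existsP/existsP => -[Phi /andP[PhiH ePhi]].
  move: PhiH; rewrite finset.in_setU1 => /orP[/eqP PhiP|PhiH].
    by rewrite -PhiP ePhi in eP.
  by exists Phi; rewrite PhiH.
by exists Phi; rewrite finset.in_setU1 PhiH orbT.
Qed.

Lemma edge_prob01 (R : realType) (d n : nat) (p q c : R) (H : hypergraph d n)
    (e : subsets 2 n) :
  0 <= q -> q <= p -> p <= 1 - c -> 0 < c ->
  0 <= (if e \in projection H then p else q) <= 1.
Proof. by move=> q0 qp p1 c0; case: ifP => _; apply/andP; split; lra. Qed.

(** Adding [Psi] alters edge probabilities only at the ['C(d, 2)] pairs inside [Psi]; these are all
    absent from [A], and each is absent with probability at least [1 - p >= c]. *)
Lemma graph_mass_setU1 (R : realType) (d n : nat) (p q c : R)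
    (Psi : subsets d n) (H : hypergraph d n) (A : graph n) :
  0 <= q -> q <= p -> p <= 1 - c -> 0 < c ->
  [disjoint A & inner_pairs Psi] ->
  c ^+ 'C(d, 2) * graph_mass p q H A <= graph_mass p q (Psi |: H) A.
Proof.
move=> q0 qp p1 c0 dA; rewrite -(card_inner_pairs Psi).
apply: indep_mass_compare => //.
- by move=> e; apply: edge_prob01 p1 c0.
- exact: ltW.
- by move=> e _; case: ifP => _; lra.
- by move=> e eP; rewrite projection_setU1.
Qed.

Lemma sum_graph_mass_disjoint (R : realType) (d n : nat) (p q c : R)
    (Psi : subsets d n) (H : hypergraph d n) :
  0 <= q -> q <= p -> p <= 1 - c -> 0 < c ->
  c ^+ 'C(d, 2) <=
    \sum_(A : graph n | [disjoint A & inner_pairs Psi]) graph_mass p q H A.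
Proof.
move=> q0 qp p1 c0.
rewrite sum_indep_mass_disjoint -(card_inner_pairs Psi) -prodr_const.
by apply: ler_prod => e _; case: ifP => _; apply/andP; split; lra.
Qed.

(** One factor [c ^+ 'C(d, 2)] bounds the probability of no edge inside [Psi], the other the
    likelihood ratio. *)
Lemma hyperedge_error (R : realType) (d n : nat) (s p q c : R)
    (Psi : subsets d n) (Hhat : graph n -> hypergraph d n) :
  0 <= s -> s <= 1 / 2 -> 0 <= q -> q <= p -> p <= 1 - c -> 0 < c ->
  c ^+ 'C(d, 2) ^+ 2 * s <=
    model_expectation s p q
      (fun H A => (Psi \in symdiff (Hhat A) H)%:R).
Proof.
move=> s0 s_half q0 qp p1 c0; have c1 : c <= 1 by lra.
have hm0 (H : hypergraph d n) : 0 <= hypergraph_mass s H.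
  by apply: indep_mass_ge0 => _; apply/andP; split; lra.
have gm0 (H : hypergraph d n) A : 0 <= graph_mass p q H A.
  by apply: indep_mass_ge0 => e; apply: edge_prob01 p1 c0.
set K := c ^+ 'C(d, 2).
have K0 : 0 <= K by rewrite exprn_ge0 // ltW.
have K1 : K <= 1 by rewrite exprn_ile1 // ltW.
rewrite /model_expectation (sum_setU1 Psi).
(* Spread the bound over the total prior mass [1], so that it suffices to compare within each pair
   [H], [Psi |: H]. *)
rewrite -[leLHS]mulr1.
rewrite -[X in _ * X <= _](sum_indep_mass (fun _ : subsets d n => s)).
rewrite (sum_setU1 Psi) mulr_sumr; apply: ler_sum => H PsiH.
set m := _ + _.
have [mH mPH] := indep_mass_setU1 s PsiH; rewrite -/m in mH mPH.
have m0 : 0 <= m by apply: addr_ge0; apply: hm0.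
rewrite -big_split /=.
apply: (@le_trans _ _ (\sum_(A : graph n | [disjoint A & inner_pairs Psi])
   K * s * m * graph_mass p q H A)).
  rewrite -mulr_sumr expr2 -!mulrA ler_wpM2l // mulrC -mulrA.
  by rewrite !ler_wpM2l // sum_graph_mass_disjoint.
rewrite big_mkcond; apply: ler_sum => A _.
have gH := gm0 H A; have gPH := gm0 (Psi |: H) A.
case: ifPn => [dA|_]; last first.
  by rewrite addr_ge0 ?mulr_ge0 ?ler0n.
rewrite /hypergraph_mass mH mPH !inE eqxx (negbTE PsiH) /= andbT andbF orbF.
(* If [Psi] is chosen, the error is at [H], and [K * s <= s <= 1 - s] because [s <= 1 / 2].
   Otherwise it is at [Psi |: H], where the likelihood comparison applies. *)
case: (Psi \in Hhat A) => /=; rewrite ?mulr1 ?mulr0 ?addr0 ?add0r.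
  rewrite ler_wpM2r // ler_wpM2r //.
  by apply: (@le_trans _ _ s); [rewrite ler_piMl | lra].
rewrite -mulrA [K * s]mulrC -!mulrA ler_wpM2l // mulrCA ler_wpM2l //.
exact: graph_mass_setU1.
Qed.

Lemma estimator_error (R : realType) (d n : nat) (s p q c : R)
    (Hhat : graph n -> hypergraph d n) :
  0 <= s -> s <= 1 / 2 -> 0 <= q -> q <= p -> p <= 1 - c -> 0 < c ->
  c ^+ 'C(d, 2) ^+ 2 * (s * ('C(n, d))%:R) <=
    model_expectation s p q (fun H A => #|symdiff (Hhat A) H|%:R).
Proof.
move=> s0 s_half q0 qp p1 c0.
(* Linearity of expectation, the cardinality being a sum of indicators. *)
have -> : model_expectation s p q (fun H A => #|symdiff (Hhat A) H|%:R) =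
    \sum_(Psi : subsets d n) model_expectation s p q
      (fun H A => (Psi \in symdiff (Hhat A) H)%:R).
  rewrite /model_expectation [RHS]exchange_big /=; apply: eq_bigr => H _.
  rewrite [RHS]exchange_big /=; apply: eq_bigr => A _.
  by rewrite -mulr_sumr -natr_sum -sum1_card big_mkcond.
rewrite -(card_subsets d n) mulrA mulr_natr -sumr_const.
by apply: ler_sum => Psi _; apply: hyperedge_error.
Qed.

(** Eventually [a + eps n] is below [a / 2], and [n] to the negative power [a / 2] tends to [0]. *)
Lemma power_o1_near_le_half (R : realType) (u : nat -> R) (a : R) :
  a < 0 -> power_o1 u a -> \forall n \near \oo%classic, u n <= 1 / 2.
Proof.
move=> a0 [eps eps0 hu].
have b0 : 0 < - a / 2 by lra.
near=> n.
have -> : u n = n%:R `^ (a + eps n) by near: n.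
have n1 : (1 : R) <= n%:R by rewrite ler1n; near: n; exact: nbhs_infty_gt.
(* This threshold is the number whose power [- a / 2] equals [2]. *)
have hn : (2 : R) `^ (- a / 2)^-1 <= n%:R by near: n; exact: nbhs_infty_ger.
have he : eps n < - a / 2.
  by near: n; apply: (cvgr_lt (0 : R)).
apply: (@le_trans _ _ (n%:R `^ (- (- a / 2)))).
  by rewrite ler_powR //; lra.
rewrite powRN div1r lef_pV2 ?posrE ?powR_gt0 //; last lra.
have two : 2 = (2 `^ (- a / 2)^-1) `^ (- a / 2).
  by rewrite -powRrM mulVf ?powRr1 ?lt0r_neq0.
by rewrite [leLHS]two; apply: ge0_ler_powR hn; rewrite ?nnegrE ?powR_ge0 //; lra.
Unshelve. all: by end_near. Qed.

Theorem proposition2p9 (R : realType) (d : nat) (delta : R)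
    (s p q : nat -> R)
    (hd : (2 <= d)%N)
    (hdelta : 0 <= delta < 1)
    (hs01 : forall n, 0 <= s n <= 1)
    (hs : power_o1 s (- (d%:R - 1) + delta))
    (hpq : forall n, 0 <= q n /\ q n <= p n /\ p n <= 1)
    (hp : exists2 c0 : R, 0 < c0 & \forall n \near \oo%classic, p n <= 1 - c0)
    (Hhat : forall n, graph n -> hypergraph d n) :
  Omega1
    (fun n => model_expectation (s n) (p n) (q n)
                (fun H A => #|symdiff (Hhat n A) H|%:R))
    (fun n => s n * ('C(n, d))%:R).
Proof.
(* The constant depends only on [d] and the gap between [p] and [1], so it is uniform in [q],
   including [q = 0]. *)
case: hp => c c0 hp; exists (c ^+ 'C(d, 2) ^+ 2); first by rewrite !exprn_gt0.
have s_half : \forall n \near \oo%classic, s n <= 1 / 2.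
  apply: power_o1_near_le_half hs.
  (* The exponent is negative: [- (d - 1) + delta <= -1 + delta < 0]. *)
  have : (2 : R) <= d%:R by rewrite ler_nat.
  by case/andP: hdelta => ? ?; lra.
near=> n.
have [q0 [qp _]] := hpq n; have /andP[s0 _] := hs01 n.
by apply: estimator_error => //; near: n.
Unshelve. all: by end_near. Qed.
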